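(* Let $\mathbb{S}=\{S^i:i\in I\}$ be a market of nonnegative semimartingales and let $T\in(0,\infty)$. Let $(\mathcal{K}_\alpha)_{\alpha\geq0}$ be one of the families $$(\mathcal{I}_\alpha(\mathbb{S}))_{\alpha\geq0},\quad(\mathcal{I}^{\rm adm}_\alpha(\mathbb{S}))_{\alpha\geq0},\quad(\mathcal{I}^{+}_\alpha(\mathbb{S}))_{\alpha\geq0}.$$ If $\mathcal{K}_1$ satisfies NA$_1$, then $\mathcal{K}_0$ satisfies NA.
   Context: Let $(\Omega,\mathcal{F},(\mathcal{F}_t)_{t\in\mathbb{R}_+},\mathbb{P})$ be a stochastic basis satisfying the usual conditions with $\mathcal{F}_0$ $\mathbb{P}$-trivial; processes are identified up to indistinguishability. $I\neq\emptyset$ is an arbitrary index set and $(S^i)_{i\in I}$ are real-valued semimartingales with $S^i\geq0$. For an $\mathbb{R}^d$-valued semimartingale $X$, $L(X)$ is the set of (predictable) $X$-integrable processes in the sense of vector stochastic integration and $\delta\bullet X$ the stochastic integral (with $(\delta\bullet X)_0=0$). A strategy for $\mathbb{S}$ is a process $\delta=(\delta^i)_{i\in I}$ such that $F:=\{i\in I:\delta^i\neq0\}$ is finite and $\delta^F=(\delta^i)_{i\in F}\in L(S^F)$, $S^F=(S^i)_{i\in F}$; $\Delta(\mathbb{S})$ is the set of strategies. Put $\delta\bullet S:=\delta^F\bullet S^F$ and $I^{\alpha,\delta}:=\alpha+\delta\bullet S$. A process $X$ is admissible if $X\geq-a$ for some constant $a\in\mathbb{R}_+$. For $\alpha\geq0$: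 $\mathbb{I}_\alpha(\mathbb{S}):=\{I^{\alpha,\delta}:\delta\in\Delta(\mathbb{S})\}$, $\mathbb{I}^{\rm adm}_\alpha(\mathbb{S})$ is its subset of admissible processes and $\mathbb{I}^+_\alpha(\mathbb{S})$ its subset of processes $X\geq0$. $\mathcal{I}_\alpha(\mathbb{S}),\mathcal{I}^{\rm adm}_\alpha(\mathbb{S}),\mathcal{I}^+_\alpha(\mathbb{S})$ consist of the terminal values $X_T$ of the processes $X$ in the corresponding set; they are subsets of $L^0=L^0(\Omega,\mathcal{F}_T,\mathbb{P})$ (a.s. equivalence classes, a.s. order). Let $\mathcal{B}:=(\mathcal{K}_1-L^0_+)\cap L^0_+$ and $p_{\mathcal{B}}(\xi):=\inf\{\alpha>0:\xi\in\alpha\mathcal{B}\}\in[0,\infty]$. $\mathcal{K}_1$ satisfies NA$_1$ if $p_{\mathcal{B}}(\xi)>0$ for all $\xi\in L^0_+\setminus\{0\}$. $\mathcal{K}_0$ satisfies NA if $\mathcal{K}_0\cap L^0_+=\{0\}$. *)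

(* Defs.v *)
(* MathComp / MathComp-Analysis, over an abstract realType. *)
From HB Require Import structures.
From mathcomp Require Import all_boot all_order all_algebra finmap.
From mathcomp Require Import all_classical all_reals all_analysis.
Set Implicit Arguments.
Unset Strict Implicit.
Unset Printing Implicit Defensive.
Import Order.TTheory GRing.Theory Num.Theory.
Import numFieldNormedType.Exports.
Local Open Scope classical_set_scope.
Local Open Scope ring_scope.

(* The time axis R_+ is the half-line [0, +oo[ of R: families indexed by time
   are functions on R of which only the values at t >= 0 are ever used. *)
Definition process (R : realType) (Omega : Type) : Type := R -> Omega -> R.

Section StochasticCalculus.
Context {R : realType} {d : measure_display} {Omega : measurableType d}.
Context (P : probability Omega R) (F : R -> set (set Omega)).
Implicit Types (X Y Z M A H : process R Omega) (xi : Omega -> R).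

Definition filtration : Prop :=
  (forall t, 0 <= t -> sigma_algebra setT (F t) /\ F t `<=` measurable) /\
  (forall s t, 0 <= s -> s <= t -> F s `<=` F t).

(* P.-negligible sets are arbitrary subsets of measurable P-null sets, so the
   last clause also makes the underlying probability space complete. *)
Definition usual_conditions : Prop :=
  (forall t, 0 <= t -> F t = \bigcap_(s in [set s | t < s]) F s) /\
  (forall N, P.-negligible N -> F 0 N).

Definition stochastic_basis : Prop := filtration /\ usual_conditions.

Definition trivial_initial : Prop := forall B, F 0 B -> P B = 0%E \/ P B = 1%E.

Definition meas_wrt (G : set (set Omega)) xi : Prop :=
  forall B : set R, measurable B -> G (xi @^-1` B).

Definition adapted X : Prop := forall t, 0 <= t -> meas_wrt (F t) (X t).

Definition indist X Y : Prop :=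
  {ae P, forall w, forall t, 0 <= t -> X t w = Y t w}.

(* Path properties are required for almost all paths, so that they are
   invariant under indistinguishability. *)
Definition cadlag X : Prop :=
  {ae P, forall w, forall t, 0 <= t ->
     (X s w @[s --> t^'+] --> X t w) /\
     (0 < t -> cvg (X s w @[s --> t^'-]))}.

Definition finite_variation A : Prop :=
  [/\ adapted A, cadlag A &
      {ae P, forall w, forall t, 0 < t -> bounded_variation 0 t (A ^~ w)}].

Definition martingale M : Prop :=
  [/\ adapted M, cadlag M,
      forall t, 0 <= t -> P.-integrable setT (EFin \o M t) &
      forall s t B, 0 <= s -> s <= t -> F s B ->
        (\int[P]_(w in B) (M t w)%:E = \int[P]_(w in B) (M s w)%:E)%E].

Definition stopping_time (tau : Omega -> \bar R) : Prop :=
  (forall w, 0 <= tau w)%E /\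
  (forall t, 0 <= t -> F t [set w | tau w <= t%:E]%E).

Definition stopped (tau : Omega -> \bar R) X : process R Omega :=
  fun t w => X (fine (mine t%:E (tau w))) w.

Definition local_martingale M : Prop :=
  [/\ adapted M, cadlag M &
      exists tau : nat -> Omega -> \bar R,
        [/\ forall n, stopping_time (tau n),
            {ae P, forall w, nondecreasing_seq (tau ^~ w)},
            {ae P, forall w, tau n w @[n --> \oo] --> +oo%E} &
            forall n, martingale (stopped (tau n) M)]].

Definition semimartingale X : Prop :=
  [/\ adapted X, cadlag X &
      exists M A, [/\ local_martingale M, finite_variation A &
                      indist X (fun t w => M t w + A t w)]].

Definition predictable_rectangles : set (set (R * Omega)) :=
  [set C | (exists2 B, F 0 B & C = [set 0] `*` B) \/
           (exists s t B, [/\ 0 <= s, s < t, F s B & C = `]s, t] `*` B])].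

Definition predictable H : Prop :=
  forall B : set R, measurable B ->
    <<s [set tw | 0 <= tw.1], predictable_rectangles >>
      [set tw | 0 <= tw.1 /\ B (H tw.1 tw.2)].

Definition bounded_by (C : R) H : Prop :=
  forall t w, 0 <= t -> `|H t w| <= C.

Definition bounded_predictable H : Prop :=
  predictable H /\ exists C, bounded_by C H.

(* J is the integral H |-> H . X on bounded predictable integrands, given by
   its universal property: the extension, unique up to indistinguishability,
   of the elementary integral which is linear and satisfies bounded
   convergence in probability (Jacod-Shiryaev, Theorem I.4.31). *)
Definition integral_map X (J : process R Omega -> process R Omega) : Prop :=
  [/\ forall H, bounded_predictable H -> adapted (J H) /\ cadlag (J H),
      forall (xi : Omega -> R), meas_wrt (F 0) xi ->
        (exists C, forall w, `|xi w| <= C) ->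
        indist (J (fun t w => (t == 0)%:R * xi w)) (fun _ _ => 0),
      forall (r s : R) (xi : Omega -> R), 0 <= r -> r < s ->
        meas_wrt (F r) xi -> (exists C, forall w, `|xi w| <= C) ->
        indist (J (fun t w => (r < t <= s)%R%:R * xi w))
               (fun t w => xi w * (X (Num.min s t) w - X (Num.min r t) w)),
      forall (a b : R) H K, bounded_predictable H -> bounded_predictable K ->
        indist (J (fun t w => a * H t w + b * K t w))
               (fun t w => a * J H t w + b * J K t w) &
      forall (Hn : nat -> process R Omega) H (C : R),
        (forall n, predictable (Hn n)) -> predictable H ->
        (forall n, bounded_by C (Hn n)) ->
        (forall t w, 0 <= t -> Hn n t w @[n --> \oo] --> H t w) ->
        forall t e, 0 <= t -> 0 < e ->
          P [set w | e <= `|J (Hn n) t w - J H t w|] @[n --> \oo] --> 0%E].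

(* "Z = H . X" for a bounded predictable H *)
Definition is_bounded_integral H X Z : Prop :=
  bounded_predictable H /\ exists2 J, integral_map X J & indist Z (J H).

(* Vector integration, for a finite set D of coordinates (R^D in the role
   of R^d). *)

Definition below (D : finType) (H : D -> process R Omega) (a : R)
    : process R Omega :=
  fun t w => (Num.sqrt (\sum_j H j t w ^+ 2) <= a)%R%:R.

(* "H is X-integrable and Y = H . X": a predictable, possibly unbounded,
   H is X-integrable when some semimartingale Y null at 0 satisfies
   1_{|H| <= a} . Y = (H 1_{|H| <= a}) . X  for all a > 0,
   where |.| is the Euclidean norm, and then Y is the integral
   (Chou-Meyer-Stricker).  Only bounded integrands occur in this identity and
   for these the vector integral is the sum of the componentwise ones; no
   component H j needs to be X j-integrable by itself. *)
Definition is_integral (D : finType) (H X : D -> process R Omega) Y : Prop :=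
  [/\ forall j, predictable (H j),
      semimartingale Y, {ae P, forall w, Y 0 w = 0} &
      forall a : R, 0 < a ->
        exists (Z : process R Omega) (Zj : D -> process R Omega),
          [/\ is_bounded_integral (below H a) Y Z,
              forall j, is_bounded_integral
                (fun t w => H j t w * below H a t w) (X j) (Zj j) &
              indist Z (fun t w => \sum_j Zj j t w)]].

Definition integrable_processes (D : finType) (X : D -> process R Omega)
    : set (D -> process R Omega) :=
  [set H | exists Y, is_integral H X Y].

End StochasticCalculus.

Section Market.
Context {R : realType} {d : measure_display} {Omega : measurableType d}.
Context (P : probability Omega R) (F : R -> set (set Omega)).
Context {I : choiceType} (S : I -> process R Omega).
Implicit Types (X Y : process R Omega) (delta : I -> process R Omega).

Definition support_of delta (E : {fset I}) : Prop :=
  forall i, (i \in E) <-> ~ indist P (delta i) (fun _ _ => 0).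

Definition restrict (E : {fset I}) (delta : I -> process R Omega)
    : E -> process R Omega := fun j => delta (val j).

Definition strategies : set (I -> process R Omega) :=
  [set delta | exists2 E : {fset I}, support_of delta E &
     integrable_processes P F (restrict (E := E) S) (restrict delta)].

(* "Z = delta . S" *)
Definition is_gain delta (Z : process R Omega) : Prop :=
  exists2 E : {fset I}, support_of delta E &
    is_integral P F (restrict (E := E) delta) (restrict S) Z.

Definition nonneg_process X : Prop :=
  {ae P, forall w, forall t, 0 <= t -> 0 <= X t w}.

Definition admissible X : Prop :=
  exists2 a : R, 0 <= a &
    {ae P, forall w, forall t, 0 <= t -> - a <= X t w}.

Definition wealth (alpha : R) : set (process R Omega) :=
  [set X | exists delta Z, [/\ strategies delta, is_gain delta Z &
     indist P X (fun t w => alpha + Z t w)]].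

Definition wealth_adm (alpha : R) : set (process R Omega) :=
  wealth alpha `&` [set X | admissible X].

Definition wealth_pos (alpha : R) : set (process R Omega) :=
  wealth alpha `&` [set X | nonneg_process X].

End Market.

(* L^0(Omega, F_T, P) is represented by the F_T-measurable functions; its
   subsets are the sets of such functions that are saturated for a.s.
   equality. *)
Section Arbitrage.
Context {R : realType} {d : measure_display} {Omega : measurableType d}.
Context (P : probability Omega R) (F : R -> set (set Omega)) (T : R).
Implicit Types (xi eta zeta : Omega -> R) (K B : set (Omega -> R)).

Definition L0 : set (Omega -> R) := [set xi | meas_wrt (F T) xi].

Definition L0_pos : set (Omega -> R) :=
  L0 `&` [set xi | {ae P, forall w, 0 <= xi w}].

Definition null_rv : set (Omega -> R) :=
  L0 `&` [set xi | {ae P, forall w, xi w = 0}].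

Definition terminal_values (W : set (process R Omega)) : set (Omega -> R) :=
  L0 `&` [set xi | exists2 X, W X & {ae P, forall w, xi w = X T w}].

Definition minus_L0_pos K : set (Omega -> R) :=
  L0 `&` [set xi | exists zeta eta,
    [/\ K zeta, L0_pos eta & {ae P, forall w, xi w = zeta w - eta w}]].

Definition dilate (alpha : R) B : set (Omega -> R) :=
  L0 `&` [set xi | exists2 b, B b & {ae P, forall w, xi w = alpha * b w}].

Definition gauge B xi : \bar R :=
  ereal_inf [set alpha%:E | alpha in [set alpha : R |
    0 < alpha /\ dilate alpha B xi]].

Definition NA1 K : Prop :=
  forall xi, L0_pos xi -> ~ null_rv xi ->
    (0 < gauge (minus_L0_pos K `&` L0_pos) xi)%E.

Definition NA K : Prop := K `&` L0_pos = null_rv.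

End Arbitrage.

(* Main.v *)
(* If xi is the terminal value of a gain process Z, then so is xi / alpha for
   Z / alpha, hence 1 + xi / alpha lies in K_1 and dominates xi / alpha.  So a
   nonzero xi >= 0 in K_0 belongs to alpha B for every alpha > 0, its gauge
   vanishes and NA1 fails.  Lower bounds survive the passage from Z to
   1 + Z / alpha, which treats the three families alike. *)
Require Import Defs.
From HB Require Import structures.
From mathcomp Require Import all_boot all_order all_algebra finmap.
From mathcomp Require Import all_classical all_reals all_analysis.
Import Order.TTheory GRing.Theory Num.Theory.
Import numFieldNormedType.Exports.
Local Open Scope classical_set_scope.
Local Open Scope ring_scope.

(** * Scaling of processes and of their stochastic integrals by constants *)

Section Scaling.
Context {R : realType} {d : measure_display} {Omega : measurableType d}.
Context {P : probability Omega R} {F : R -> set (set Omega)}.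
Implicit Types (X Y Z M A H : process R Omega) (c : R).

Lemma measurable_affine (a b : R) : measurable_fun setT (fun x : R => a + b * x).
Proof. by apply: measurable_realfun.measurable_funD => //; exact: measurable_funM. Qed.

Lemma meas_wrt_affine (G : set (set Omega)) (a b : R) (xi : Omega -> R) :
  meas_wrt G xi -> meas_wrt G (fun w => a + b * xi w).
Proof.
move=> mxi B mB; apply: (mxi ((fun x => a + b * x) @^-1` B)).
by rewrite -[X in measurable X]setTI; exact: measurable_affine.
Qed.

Lemma meas_wrtZ (G : set (set Omega)) c (xi : Omega -> R) :
  meas_wrt G xi -> meas_wrt G (fun w => c * xi w).
Proof.
move=> /(meas_wrt_affine _ 0 c); congr meas_wrt.
by apply/funext => w; rewrite add0r.
Qed.

Lemma meas_wrt_cst (G : set (set Omega)) c :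
  sigma_algebra setT G -> meas_wrt G (fun _ => c).
Proof.
move=> [G0 GC _] B _; rewrite preimage_cst; case: ifP => _ //.
by rewrite -(setD0 [set: Omega]); exact: GC.
Qed.

Lemma adaptedZ c X : adapted F X -> adapted F (fun t w => c * X t w).
Proof. move=> aX t t0; apply: meas_wrtZ; exact: aX. Qed.

Lemma cadlagZ c X : cadlag P X -> cadlag P (fun t w => c * X t w).
Proof.
apply: filterS => w Xw t t0; have [Xr Xl] := Xw t t0; split.
  exact: cvgMl_tmp.
by move=> /Xl; exact: is_cvgMl_tmp.
Qed.

Lemma cadlag_cst c : cadlag P (fun _ _ => c).
Proof.
apply: aeW => w t _; split; first exact: cvg_cst.
by move=> _; exact: is_cvg_cst.
Qed.

Lemma indist_refl X : indist P X X.
Proof. exact: aeW. Qed.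

Lemma indistZ c X Y :
  indist P X Y -> indist P (fun t w => c * X t w) (fun t w => c * Y t w).
Proof. by apply: filterS => w XY t t0; rewrite XY. Qed.

Lemma indistZ0 c X : c != 0 ->
  indist P (fun t w => c * X t w) (fun _ _ => 0) <-> indist P X (fun _ _ => 0).
Proof.
move=> c0; split; last first.
  by apply: filterS => w X0 t t0; rewrite X0// mulr0.
apply: filterS => w X0 t t0; have /eqP := X0 t t0.
by rewrite mulf_eq0 (negbTE c0) => /eqP.
Qed.

Lemma variationZ (a b c : R) (f : R -> R) s :
  variation a b (fun x => c * f x) s = `|c| * variation a b f s.
Proof.
rewrite /variation mulr_sumr; apply: eq_bigr => i _.
by rewrite -mulrBr normrM.
Qed.

Lemma bounded_variationZ (a b c : R) (f : R -> R) :
  bounded_variation a b f -> bounded_variation a b (fun x => c * f x).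
Proof.
move=> [m ubm]; exists (`|c| * m) => _ [s abs <-]; rewrite variationZ.
by apply: ler_wpM2l => //; apply: ubm; exists s.
Qed.

Lemma finite_variationZ c A :
  finite_variation P F A -> finite_variation P F (fun t w => c * A t w).
Proof.
move=> [aA cA bA]; split; [exact: adaptedZ|exact: cadlagZ|].
apply: filterS bA => w Aw t t0; exact/bounded_variationZ/Aw.
Qed.

Lemma martingaleZ c M : filtration F ->
  martingale P F M -> martingale P F (fun t w => c * M t w).
Proof.
move=> [Fm FS] [aM cM iM eM]; split; [exact: adaptedZ|exact: cadlagZ| |].
  by move=> t t0; exact: (integrableZl measurableT c (iM t t0)).
move=> s t B s0 st FsB.
have mB : measurable B by have [_] := Fm s s0; exact.
have iMB r : 0 <= r -> P.-integrable B (EFin \o M r).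
  by move=> r0; apply: (integrableS measurableT) => //; exact: iM.
under eq_integral do rewrite EFinM.
under [RHS]eq_integral do rewrite EFinM.
rewrite (integralZl mB (iMB t (le_trans s0 st))) (integralZl mB (iMB s s0)).
by rewrite (eM s).
Qed.

Lemma local_martingaleZ c M : filtration F ->
  local_martingale P F M -> local_martingale P F (fun t w => c * M t w).
Proof.
move=> hF [aM cM [tau [stau ndtau cvtau mM]]].
split; [exact: adaptedZ|exact: cadlagZ|exists tau; split => // n].
(* Stopping commutes with scaling by mere computation, so the localizing sequence of [M] serves
   again. *)
exact: (martingaleZ c _ hF (mM n)).
Qed.

Lemma semimartingaleZ c X : filtration F ->
  semimartingale P F X -> semimartingale P F (fun t w => c * X t w).
Proof.
move=> hF [aX cX [M [A [lM fA XMA]]]]; split; [exact: adaptedZ|exact: cadlagZ|].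
exists (fun t w => c * M t w), (fun t w => c * A t w).
split; [exact: local_martingaleZ|exact: finite_variationZ|].
by apply: filterS XMA => w e t t0; rewrite e// mulrDr.
Qed.

Lemma predictableZ c H : predictable F H -> predictable F (fun t w => c * H t w).
Proof.
move=> pH B mB; apply: (pH ((fun x => c * x) @^-1` B)).
by rewrite -[X in measurable X]setTI; exact: measurable_realfun.mulrl_measurable.
Qed.

Lemma predictable_cst c : predictable F (fun _ _ => c).
Proof.
move=> B _ G [[G0 GC _] _]; have [Bc|nBc] := pselect (B c).
  (* Complements are taken in the half-space of times [t >= 0], which is thus the complement of the
     empty set. *)
  rewrite (_ : [set _ | _] = [set tw | 0 <= tw.1] `\` set0); first exact: GC.
  by rewrite setD0; apply/seteqP; split => x //= [].
by rewrite (_ : [set _ | _] = set0)//; apply/seteqP; split => x //= [].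
Qed.

Lemma bounded_predictableZ c H :
  bounded_predictable F H -> bounded_predictable F (fun t w => c * H t w).
Proof.
move=> [pH [C HC]]; split; first exact: predictableZ.
exists (`|c| * C) => t w t0; rewrite normrM.
by apply: ler_wpM2l => //; exact: HC.
Qed.

(** Every clause of the universal property is homogeneous in the integrator. Scaling integrators
    matters because [is_integral] integrates against the gain process itself. *)
Lemma integral_mapZ c X J : c != 0 ->
  integral_map P F X J ->
  integral_map P F (fun t w => c * X t w) (fun H t w => c * J H t w).
Proof.
move=> c0 [J1 J2 J3 J4 J5]; split.
- by move=> H /J1[? ?]; split; [exact: adaptedZ|exact: cadlagZ].
- by move=> xi mxi bxi; apply/indistZ0 => //; exact: J2.
- move=> r s xi r0 rs mxi bxi; apply: filterS (J3 r s xi r0 rs mxi bxi).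
  by move=> w e t t0; rewrite e// mulrCA -mulrBr.
- move=> a b H K bH bK; apply: filterS (J4 a b H K bH bK).
  by move=> w e t t0; rewrite e// mulrDr !(mulrCA c).
- move=> Hn H C pHn pH bHn cH t e t0 e0.
  (* The scaled integrals deviate by [e] exactly when the original ones deviate by [e] over the
     modulus of [c]; here [c != 0] enters. *)
  have e1 : 0 < e / `|c| by rewrite divr_gt0// normr_gt0.
  have PE n : P [set w | e <= `|c * J (Hn n) t w - c * J H t w|] =
              P [set w | e / `|c| <= `|J (Hn n) t w - J H t w|].
    congr (P _); apply/seteqP; split => w /=;
      by rewrite -mulrBr normrM ler_pdivrMr ?normr_gt0// mulrC.
  by under eq_fun do rewrite PE; exact: J5.
Qed.

(** This is the integral map of the gain process of an empty portfolio. *)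
Lemma integral_map0 : filtration F ->
  integral_map P F (fun _ _ => 0) (fun _ _ _ => 0).
Proof.
move=> [Fm _]; split.
- move=> H _; split; last exact: cadlag_cst.
  by move=> t /Fm[? _]; exact: meas_wrt_cst.
- by move=> *; exact: indist_refl.
- by move=> *; apply: aeW => w t _; rewrite subrr mulr0.
- by move=> *; apply: aeW => w t _; rewrite !mulr0 addr0.
- move=> Hn H C _ _ _ _ t e _ e0.
  rewrite (_ : [set _ | _] = set0); last first.
    by apply/seteqP; split => w //=; rewrite subrr normr0 leNgt e0.
  by rewrite measure0; exact: cvg_cst.
Qed.

Lemma is_bounded_integralZl c H X Z : c != 0 ->
  is_bounded_integral P F H X Z ->
  is_bounded_integral P F H (fun t w => c * X t w) (fun t w => c * Z t w).
Proof.
move=> c0 [bH [J XJ ZJ]]; split => //.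
exists (fun H t w => c * J H t w); first exact: integral_mapZ.
exact: indistZ.
Qed.

Lemma is_bounded_integralZr c H X Z :
  is_bounded_integral P F H X Z ->
  is_bounded_integral P F (fun t w => c * H t w) X (fun t w => c * Z t w).
Proof.
move=> [bH [J XJ ZJ]]; split; first exact: bounded_predictableZ.
exists J => //; have [_ _ _ J4 _] := XJ.
(* Linearity is stated for two-term combinations, hence the dummy term [0 * H]. *)
have -> : (fun t w => c * H t w) = (fun t w => c * H t w + 0 * H t w).
  by apply/funext => t; apply/funext => w; rewrite mul0r addr0.
have := J4 c 0 H H bH bH; apply: filterS2 ZJ => w ZJ JH t t0.
by rewrite JH// ZJ// mul0r addr0.
Qed.

(** The Euclidean norm is positively homogeneous, so scaling the integrand only moves the truncation
    level. *)
Lemma belowZ (D : finType) (H : D -> process R Omega) (c a : R) : 0 < c ->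
  below (fun j t w => c * H j t w) a = below H (a / c).
Proof.
move=> c0; apply/funext => t; apply/funext => w; rewrite /below.
under eq_bigr do rewrite exprMn.
rewrite -mulr_sumr sqrtrM ?sqr_ge0// sqrtr_sqr gtr0_norm//.
by rewrite ler_pdivlMr// mulrC.
Qed.

(** The defining identity for [c * H] at level [a] is [c] times the one for [H] at level [a / c].
    The factor enters through the integrator [Y] on the left and through the integrands on the
    right. *)
Lemma is_integralZ (D : finType) (H X : D -> process R Omega) Y c :
  filtration F -> 0 < c -> is_integral P F H X Y ->
  is_integral P F (fun j t w => c * H j t w) X (fun t w => c * Y t w).
Proof.
move=> hF c0 [pH sY Y0 HXY]; split.
- by move=> j; exact: predictableZ.
- exact: semimartingaleZ.
- by apply: filterS Y0 => w ->; rewrite mulr0.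
- move=> a a0; have [Z [Zj [YZ XZj ZE]]] := HXY (a / c) (divr_gt0 a0 c0).
  exists (fun t w => c * Z t w), (fun j t w => c * Zj j t w).
  rewrite belowZ//; split.
  + by apply: is_bounded_integralZl => //; rewrite gt_eqF.
  + move=> j; have := is_bounded_integralZr c _ _ _ (XZj j).
    congr is_bounded_integral.
    by apply/funext => t; apply/funext => w; rewrite mulrA.
  + by apply: filterS ZE => w e t t0; rewrite e// mulr_sumr.
Qed.

(** Without coordinates the norm of [H] is an empty sum, so each truncation is constantly 1 and the
    identity reads [0 = 0]. *)
Lemma is_integral_void (D : finType) (H X : D -> process R Omega) :
  filtration F -> (D -> False) -> semimartingale P F (fun _ _ => 0) ->
  is_integral P F H X (fun _ _ => 0).
Proof.
move=> hF D0 s0; split => //; first exact: aeW.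
move=> a a0; exists (fun _ _ => 0), (fun _ _ _ => 0).
have bE : below H a = fun _ _ => 1.
  apply/funext => t; apply/funext => w; by rewrite /below big1 ?sqrtr0 ?ltW//.
split.
- rewrite bE; split.
    by split; [exact: predictable_cst|exists 1 => t w _; rewrite normr1].
  exists (fun _ _ _ => 0); last exact: indist_refl.
  exact: integral_map0.
- by move=> j; case: (D0 j).
- by apply: aeW => w t _; rewrite big1.
Qed.

End Scaling.

(** * Wealth processes under scaling and change of initial capital *)

Section MarketScaling.
Context {R : realType} {d : measure_display} {Omega : measurableType d}.
Context {P : probability Omega R} {F : R -> set (set Omega)}.
Context {I : choiceType} {S : I -> process R Omega}.
Hypothesis hF : filtration F.

(** Scaling the strategy by [c] keeps its support, as [c] is nonzero, and scales the gain; the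
    initial capital can then be chosen freely. *)
Lemma wealth_affine (b c : R) X : 0 < c ->
  wealth P F S 0 X -> wealth P F S b (fun t w => b + c * X t w).
Proof.
move=> c0 [delta [Z [_ [E sE iZ] XZ]]].
have sE' : support_of P (fun i t w => c * delta i t w) E.
  move=> i; split=> [/sE nd|nd]; first by move/indistZ0 => /(_ (lt0r_neq0 c0)).
  by apply/sE => /indistZ0 => /(_ c (lt0r_neq0 c0)).
have iZ' := is_integralZ _ _ _ _ c hF c0 iZ.
exists (fun i t w => c * delta i t w), (fun t w => c * Z t w); split.
- by exists E => //; exists (fun t w => c * Z t w).
- by exists E.
- by apply: filterS XZ => w e t t0; rewrite e// add0r.
Qed.

(** The zero strategy has empty support, so its gain is the void integral. *)
Lemma wealth_cst (b : R) : semimartingale P F (fun _ _ => 0) ->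
  wealth P F S b (fun _ _ => b).
Proof.
move=> s0; have sE : support_of P (fun (_ : I) _ _ => 0) fset0.
  by move=> i; rewrite inE; split => // n0; exfalso; exact/n0/indist_refl.
have iZ : is_integral P F
    (Defs.restrict (E := fset0) (fun _ _ _ => 0)) (Defs.restrict S)
    (fun _ _ => 0).
  by apply: is_integral_void => // -[].
exists (fun _ _ _ => 0), (fun _ _ => 0); split.
- by exists fset0 => //; exists (fun _ _ => 0).
- by exists fset0.
- by apply: aeW => w t _; rewrite addr0.
Qed.

End MarketScaling.

(** * From NA1 to NA for sets of random variables *)

Section Arbitrage.
Context {R : realType} {d : measure_display} {Omega : measurableType d}.
Context {P : probability Omega R} {F : R -> set (set Omega)} {T : R}.

(** The argument isolated from stochastic integration: the two closure properties assumed here are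
    all that has to be checked for each family. *)
Lemma NA1_NA (K0 K1 : set (Omega -> R)) :
  sigma_algebra setT (F T) -> null_rv P F T `<=` K0 ->
  (forall c xi, 0 < c -> K0 xi -> K1 (fun w => 1 + c * xi w)) ->
  NA1 P F T K1 -> NA P F T K0.
Proof.
move=> sF n0 K01 na1; apply/seteqP; split; last first.
  move=> xi n; split; [exact: n0|case: n => ? e; split => //].
  by apply: filterS e => w ->.
move=> xi [Kxi Lxi]; apply: contrapT => nxi.
have := na1 xi Lxi nxi; rewrite ltNge => /negP; apply.
have [mxi xi0] := Lxi.
(* The gauge is at most 0 once every [a > 0] is an admissible dilation factor. *)
apply/lee_addgt0Pr => a a0; rewrite add0e; apply: ereal_inf_lbound.
exists a => //; split => //; split => //.
exists (fun w => a^-1 * xi w); last by apply: aeW => w; rewrite mulVKf ?gt_eqF.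
have ai0 : 0 < a^-1 by rewrite invr_gt0.
have Lb : L0 F T (fun w => a^-1 * xi w) by exact: meas_wrtZ.
split; split => //; last first.
  by apply: filterS xi0 => w xiw /=; rewrite mulr_ge0// ltW.
(* Subtracting the constant 1, an element of [L0_pos], removes the initial capital and leaves [xi]
   divided by [a]. *)
exists (fun w => 1 + a^-1 * xi w), (fun=> 1); split; first exact: K01.
  by split; [exact: meas_wrt_cst|apply: aeW => w; exact: ler01].
by apply: aeW => w; rewrite addrAC subrr add0r.
Qed.

Lemma terminal_affine (b c : R) (W0 W1 : set (process R Omega)) xi :
  (forall X, W0 X -> W1 (fun t w => b + c * X t w)) ->
  terminal_values P F T W0 xi ->
  terminal_values P F T W1 (fun w => b + c * xi w).
Proof.
move=> W01 [mxi [X WX e]]; split; first exact: meas_wrt_affine.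
exists (fun t w => b + c * X t w); first exact: W01.
by apply: filterS e => w ->.
Qed.

Lemma null_rv_terminal (W : set (process R Omega)) :
  W (fun _ _ => 0) -> null_rv P F T `<=` terminal_values P F T W.
Proof. by move=> W0 xi [mxi e]; split => //; exists (fun _ _ => 0). Qed.

End Arbitrage.

Theorem proposition7p26 (R : realType) (d : measure_display)
    (Omega : measurableType d) (P : probability Omega R)
    (F : R -> set (set Omega))
    (hF : stochastic_basis P F) (hF0 : trivial_initial P F)
    (I : choiceType) (hI : inhabited I) (S : I -> process R Omega)
    (hS : forall i, semimartingale P F (S i))
    (hS0 : forall i, nonneg_process P (S i))
    (T : R) (hT : 0 < T)
    (K : R -> set (Omega -> R))
    (hK : [\/ K = (fun alpha => terminal_values P F T (wealth P F S alpha)),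
              K = (fun alpha => terminal_values P F T (wealth_adm P F S alpha)) |
              K = (fun alpha => terminal_values P F T (wealth_pos P F S alpha))]) :
  NA1 P F T (K 1) -> NA P F T (K 0).
Proof.
have [fF _] := hF; have [Fm _] := fF.
have sT : sigma_algebra setT (F T) by have [] := Fm T (ltW hT).
have s0 : semimartingale P F (fun _ _ => 0).
  (* Since [I] is inhabited, the zero process arises as 0 times some [S i]. *)
  have [i] := hI; have := semimartingaleZ 0 (S i) fF (hS i).
  congr semimartingale.
  by apply/funext => t; apply/funext => w; rewrite mul0r.
have w0 : wealth P F S 0 (fun _ _ => 0) by exact: wealth_cst.
have w01 c X : 0 < c -> wealth P F S 0 X ->
    wealth P F S 1 (fun t w => 1 + c * X t w) by exact: wealth_affine.
case: hK => ->; apply: NA1_NA => //.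
- exact: null_rv_terminal.
- by move=> c xi c0; apply: terminal_affine => X; exact: w01.
- apply: null_rv_terminal; split => //; exists 0 => //.
  by apply: aeW => w t _; rewrite oppr0.
- move=> c xi c0; apply: terminal_affine => X [wX [a a0 Xa]].
  split; first exact: w01.
  (* From [X >= - a] follows [c * X >= - (c * a)], and adding 1 preserves this bound. *)
  exists (c * a); first by rewrite mulr_ge0// ltW.
  apply: filterS Xa => w Xa t t0; rewrite -[leLHS]add0r lerD// -mulrN.
  by rewrite ler_pM2l// Xa.
- by apply: null_rv_terminal; split => //; exact: aeW.
- move=> c xi c0; apply: terminal_affine => X [wX X0].
  split; first exact: w01.
  by apply: filterS X0 => w X0 t t0; rewrite addr_ge0// mulr_ge0// ?X0// ltW.
Qed.
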